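(* Let $h:Z\to Z$ be a surjective local homeomorphism on a nonempty compact Hausdorff space $Z$. Let $$\beta_c:=\limsup_{n\to\infty}\Big(n^{-1}\ln\Big(\max_{z\in Z}|h^{-n}(z)|\Big)\Big),$$ and suppose that $\beta>\beta_c$. (a) The series $\sum_{n=0}^\infty e^{-\beta n}|h^{-n}(z)|$ converges uniformly for $z\in Z$ to a continuous function $f_\beta(z)$, which satisfies $$f_\beta(z)-\sum_{h(w)=z}e^{-\beta}f_\beta(w)=1\quad\text{for all } z\in Z.$$ (b) Suppose that $\varepsilon$ is a finite regular Borel measure on $Z$. Then the series $\sum_{n=0}^\infty e^{-\beta n}R^n\varepsilon$ converges in norm in the dual space $C(Z)^*$, with sum $\mu$, say. The measure $\mu$ satisfies the subinvariance relation $$\int a\,d(R\mu)\le e^{\beta}\int a\,d\mu\quad\text{for all positive } a\in C(Z),$$ and $\varepsilon=\mu-e^{-\beta}R\mu$. Moreover $\mu$ is a probability measure if and only if $\int f_\beta\,d\varepsilon=1$. (c) Suppose that $\mu$ is a probability measure on $Z$ which satisfies the subinvariance relation $\int a\,d(R\mu)\le e^{\beta}\int a\,d\mu$ for all positive $a\in C(Z)$. Then $\varepsilon=\mu-e^{-\beta}R\mu$ is a finite regular Borel measure satisfying $\int f_\beta\,d\varepsilon=1$, and $\mu=\sum_{n=0}^\infty e^{-\beta n}R^n\varepsilon$.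
   Context: All measures are positive (values in $[0,\infty)$) finite regular Borel measures, identified with positive functionals in $C(Z)^*$; a probability measure has total mass $1$. For a finite regular Borel measure $\nu$ on $Z$, $R\nu$ is the unique finite regular Borel measure on $Z$ such that $\int a\,d(R\nu)=\int\sum_{h(w)=z}a(w)\,d\nu(z)$ for all $a\in C(Z)$. Powers are defined by $R^0\nu=\nu$, $R^{n+1}\nu=R(R^n\nu)$. $|h^{-n}(z)|$ is the cardinality of the preimage of $z$ under the $n$-fold iterate $h^n$. *)

(* Defs.v *)
From HB Require Import structures.
From mathcomp Require Import all_boot all_order all_algebra finmap.
From mathcomp Require Import all_classical all_reals all_analysis.
Import Order.TTheory GRing.Theory Num.Theory.
Import numFieldNormedType.Exports.

Set Implicit Arguments.
Unset Strict Implicit.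
Unset Printing Implicit Defensive.

Local Open Scope classical_set_scope.
Local Open Scope ring_scope.

Definition local_homeomorphism (X Y : topologicalType) (h : X -> Y) : Prop :=
  forall x : X, exists U : set X,
    [/\ open U, U x, open (h @` U) &
        exists g : Y -> X,
          [/\ {within U, continuous h},
              {within h @` U, continuous g} &
              forall u, U u -> g (h u) = u]].

Definition fiber (X : Type) (h : X -> X) (n : nat) (z : X) : set X :=
  [set w | iter n h w = z].

(* On a compact space the fibers of a local homeomorphism are finite, so the
   default value of [fset_set] on infinite sets plays no role. *)
Definition card_fiber (X : choiceType) (h : X -> X) (n : nat) (z : X) : nat :=
  #|` fset_set (fiber h n z)|%fset.

(* The greatest element of the set of the |h^-n(z)|; the default value 0 is
   not used for a local homeomorphism of a nonempty compact Hausdorff space. *)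
Definition max_card_fiber (X : choiceType) (h : X -> X) (n : nat) : nat :=
  xget 0%N [set m | (exists z, card_fiber h n z = m) /\
                    (forall z, (card_fiber h n z <= m)%N)].

Definition beta_c (R : realType) (X : choiceType) (h : X -> X) : \bar R :=
  limn_esup (fun n : nat =>
    (n%:R^-1 * ln ((max_card_fiber h n)%:R : R))%:E).

Definition f_beta_partial (R : realType) (X : choiceType) (h : X -> X)
    (beta : R) (N : nat) (z : X) : R :=
  \sum_(n < N) expR (- beta * n%:R) * (card_fiber h n z)%:R.

Definition f_beta (R : realType) (X : choiceType) (h : X -> X)
    (beta : R) (z : X) : R :=
  limn (fun N => f_beta_partial h beta N z).

Notation borelType Z := (g_sigma_algebraType (@open Z)).

(* Measures are positive and finite by the type of [mu]. *)
Definition regular (R : realType) (Z : ptopologicalType)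
    (mu : {finite_measure set (borelType Z) -> \bar R}) : Prop :=
  forall E : set (borelType Z), measurable E ->
    mu E = ereal_inf [set mu U | U in [set U : set Z | open U /\ E `<=` U]] /\
    mu E = ereal_sup [set mu K | K in [set K : set Z | compact K /\ K `<=` E]].

Record regular_measure (R : realType) (Z : ptopologicalType) := RegularMeasure {
  measure_of :> {finite_measure set (borelType Z) -> \bar R} ;
  measure_of_regular : regular measure_of
}.

HB.instance Definition _ (R : realType) (Z : ptopologicalType) :=
  gen_eqMixin (regular_measure R Z).
HB.instance Definition _ (R : realType) (Z : ptopologicalType) :=
  gen_choiceMixin (regular_measure R Z).

Definition integ (R : realType) (Z : ptopologicalType)
    (mu : regular_measure R Z) (a : Z -> R) : R :=
  \int[mu]_z a z.

Definition fiber_sum (R : realType) (X : choiceType) (h : X -> X)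
    (a : X -> R) (z : X) : R :=
  \sum_(w \in h @^-1` [set z]) a w.

(* The operator R on measures: [transfer h nu] is the unique regular measure
   with the displayed property. It exists for every [nu] when [h] is a local
   homeomorphism of a compact Hausdorff space. *)
Definition transfer (R : realType) (Z : ptopologicalType) (h : Z -> Z)
    (nu : regular_measure R Z) : regular_measure R Z :=
  xget nu [set mu : regular_measure R Z |
    forall a : Z -> R, continuous a -> integ mu a = integ nu (fiber_sum h a)].

Definition subinvariant (R : realType) (Z : ptopologicalType) (h : Z -> Z)
    (beta : R) (mu : regular_measure R Z) : Prop :=
  forall a : Z -> R, continuous a -> (forall z, 0 <= a z) ->
    integ (transfer h mu) a <= expR beta * integ mu a.

(* The norm of C(Z)^*. *)
Definition dual_norm (R : realType) (Z : topologicalType)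
    (L : (Z -> R) -> R) : \bar R :=
  ereal_sup [set `|L a|%:E | a in
    [set a : Z -> R | continuous a /\ forall z, `|a z| <= 1]].

Definition dual_partial_sum (R : realType) (Z : ptopologicalType) (h : Z -> Z)
    (beta : R) (eps : regular_measure R Z) (N : nat) (a : Z -> R) : R :=
  \sum_(n < N) expR (- beta * n%:R) * integ (iter n (transfer h) eps) a.

(* mu = \sum_n e^(-beta n) R^n eps, with convergence in the norm of C(Z)^*. *)
Definition is_norm_sum (R : realType) (Z : ptopologicalType) (h : Z -> Z)
    (beta : R) (eps mu : regular_measure R Z) : Prop :=
  dual_norm (fun a => dual_partial_sum h beta eps N a - integ mu a)
    @[N --> \oo] --> (0 : \bar R).

(* eps = mu - e^(-beta) R mu as set functions; all the values are finite. *)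
Definition is_defect (R : realType) (Z : ptopologicalType) (h : Z -> Z)
    (beta : R) (mu eps : regular_measure R Z) : Prop :=
  forall E : set (borelType Z), measurable E ->
    eps E = (mu E - (expR (- beta))%:E * transfer h mu E)%E.

Definition is_probability (R : realType) (Z : ptopologicalType)
    (mu : regular_measure R Z) : Prop :=
  mu [set: borelType Z] = 1%E.

(* Main.v *)
(* The transfer operator [R] is dual to [a |-> fiber_sum h a], which preserves
   continuity because fibers are locally evenly covered. Regular measures are
   determined, and compared, by their integrals of nonnegative continuous
   functions (Urysohn). Since [beta > beta_c], the numbers
   [exp (- beta n) max_z |h^-n(z)|] have a finite sum and dominate both series
   (with total masses at most [exp (- beta n) max_z |h^-n(z)| eps(Z)] for the
   measures). Shifting the series for [mu] by one step gives
   [R mu = exp beta (mu - eps)], which yields (b); for (c) the partial sums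
   telescope to [mu - exp (- beta N) R^N mu] and the remainder tends to 0. *)

Require Import Defs.
From HB Require Import structures.
From mathcomp Require Import all_boot all_order all_algebra finmap.
From mathcomp Require Import all_classical all_reals all_analysis.
From mathcomp Require Import measurable_realfun ring lra.
Import Order.TTheory GRing.Theory Num.Theory.
Import numFieldNormedType.Exports.
Local Open Scope classical_set_scope.
Local Open Scope ring_scope.
Set Implicit Arguments.
Unset Strict Implicit.
Unset Printing Implicit Defensive.

(** * Continuity and measurability *)

(** No representation theorem for positive functionals is invoked: [R nu], the sum of the series and
    the defect are each built as set functions, and each must then be shown regular. For this,
    regularity is traded for [outer_approximable], which bounds the mass of an open [U] containing
    [E] outside [E]. That condition is monotone in the measure, so it passes to multiples, sums and
    differences, and on a compact space the complement of an outer approximation is an inner one.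
    Two notions of equality have to be reconciled: [R] and the series are given by integrals of
    continuous functions, while the defect is an identity between values on Borel sets.
    [integral_domination] is the bridge from the former to the latter. *)

Lemma continuous_measurable_borel (X Y : ptopologicalType) (D : set X)
    (f : X -> Y) :
  open D -> {within D, continuous f} ->
  measurable_fun (D : set (borelType X)) (f : borelType X -> borelType Y).
Proof.
move=> oD cf.
apply: (@measurability _ _ (borelType X) (borelType Y) D f (@open Y)) => //.
move=> _ [B oB <-]; apply: sub_sigma_algebra.
have : open (D `&` f @^-1` B : set X).
  by rewrite (@open_setSI _ D (f @^-1` B) oD); move/continuousP : cf; exact.
by [].
Qed.

Lemma continuous_measurable_real (R : realType) (Z : ptopologicalType)
    (a : Z -> R) :
  continuous a -> measurable_fun [set: borelType Z] (a : borelType Z -> R).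
Proof.
move=> ca; apply: (measurability _ (RGenOInfty.measurableE R)).
move=> _ [_ [x ->] <-]; rewrite setTI; apply: sub_sigma_algebra.
by move/continuousP : ca; apply; exact: interval_open.
Qed.

Lemma compact_continuous_bounded (R : realType) (Z : ptopologicalType)
    (a : Z -> R) : compact [set: Z] -> continuous a ->
  exists2 M : R, 0 < M & forall z, `|a z| <= M.
Proof.
move=> cZ ca.
have /compact_bounded/pinfty_ex_gt0[M M0 aM] : compact (a @` [set: Z]).
  by apply: continuous_compact => //; exact: continuous_subspaceT.
by exists M => // z; apply: aM; exists z.
Qed.

Lemma cvg_sumr (R : realType) (T : Type) (F : set_system T) (I : Type)
    (r : seq I) (f : I -> T -> R) (l : I -> R) : Filter F ->
  (forall i, f i x @[x --> F] --> l i) ->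
  (\sum_(i <- r) f i x) @[x --> F] --> \sum_(i <- r) l i.
Proof.
move=> FF fl; elim: r => [|i r IHr].
  by under eq_fun do rewrite big_nil; rewrite big_nil; exact: cvg_cst.
by under eq_fun do rewrite big_cons; rewrite big_cons; exact: cvgD.
Qed.

(** * Local homeomorphisms and their fibers *)

Lemma hausdorff_separate_finite (T : topologicalType) (s : seq T) :
  hausdorff_space T ->
  exists W : T -> set T, (forall x, nbhs x (W x)) /\
    {in s &, forall x y, x != y -> W x `&` W y = set0}.
Proof.
rewrite open_hausdorff => hT.
have sep (p : T * T) : exists A : set T * set T, p.1 != p.2 ->
    [/\ nbhs p.1 A.1, nbhs p.2 A.2 & A.1 `&` A.2 = set0].
  have [->|ne] := eqVneq p.1 p.2; first by exists (setT, setT) => /eqP.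
  have [A [xA yA] [oA oB AB]] := hT _ _ ne; exists A => _; split => //.
    by apply: open_nbhs_nbhs; split => //; exact: set_mem.
  by apply: open_nbhs_nbhs; split => //; exact: set_mem.
  exact/eqP.
have [A AP] := choice sep.
(* The pairs chosen for [(x, y)] and [(y, x)] are unrelated, so both are used at each point: [W x]
   and [W y] then lie in the two disjoint halves of the pair chosen for [(x, y)]. *)
pose W x := \bigcap_(y in [set` [fset y in s | y != x]%fset])
  ((A (x, y)).1 `&` (A (y, x)).2).
exists W; split=> [x|x y xs ys xy].
  apply: filter_bigI => y; rewrite !inE/= => /andP[ys yx].
  have xy : x != y by rewrite eq_sym.
  by apply: filterI; [have [] := AP (x, y) xy|have [] := AP (y, x) yx].
have yx : y != x by rewrite eq_sym.
rewrite -subset0 => z [Wx Wy].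
have [_ _ <-] := AP (x, y) xy.
have /Wx[Axy _] : [set` [fset w in s | w != x]%fset] y by rewrite /= !inE/= ys.
by have /Wy[] : [set` [fset w in s | w != y]%fset] x by rewrite /= !inE/= xs.
Qed.

Section LocalHomeomorphism.
Context (Z : ptopologicalType) (h : Z -> Z).
Hypothesis h_lh : local_homeomorphism h.

Lemma local_homeo_inverse (x : Z) : exists (U : set Z) (g : Z -> Z),
  [/\ open U, U x, open (h @` U), {within h @` U, continuous g} &
      forall u, U u -> g (h u) = u].
Proof. by have [U [oU Ux ohU [g [_ cg gh]]]] := h_lh x; exists U, g. Qed.

Lemma local_homeo_continuous : continuous h.
Proof.
move=> x; have [U [oU Ux _ [g [ch _ _]]]] := h_lh x.
move: ch; rewrite (continuous_open_subspace h oU); apply.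
exact/mem_set.
Qed.

(** The local inverse is continuous at [h x], so it sends nearby points into [W], and each of them
    is the image of its value under that inverse. *)
Lemma local_homeo_open (x : Z) (W : set Z) : nbhs x W -> nbhs (h x) (h @` W).
Proof.
have [U [g [oU Ux ohU cg gh]]] := local_homeo_inverse x => xW.
move: cg; rewrite (continuous_open_subspace g ohU) => cg.
have /cg : h x \in h @` U by apply/mem_set; exists x.
rewrite /continuous_at gh// => /(_ _ xW) hxW.
have hxU : nbhs (h x) (h @` U) by apply: open_nbhs_nbhs; split => //; exists x.
apply: filterS (filterI hxU hxW) => _ [[u Uu <-]] /=.
by rewrite gh// => Wu; exists u.
Qed.

(** The image of the complement of [O] is compact, hence closed, and it misses [z]. *)
Lemma near_fiber_sub (O : set Z) (z : Z) :
  hausdorff_space Z -> compact [set: Z] -> open O -> h @^-1` [set z] `<=` O ->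
  \forall y \near z, h @^-1` [set y] `<=` O.
Proof.
move=> hZ cZ oO zO.
have cK : compact (h @` ~` O).
  apply: continuous_compact.
    by apply: continuous_subspaceT; exact: local_homeo_continuous.
  by apply: (subclosed_compact _ cZ) => //; exact: open_closedC.
have : nbhs z (~` (h @` ~` O)).
  apply: open_nbhs_nbhs; split; first by apply: closed_openC; exact: compact_closed.
  by move=> [w nOw hw]; exact/nOw/zO.
apply: filterS => y ny w hw; apply: contrapT => nOw; apply: ny.
by exists w.
Qed.

(** The family is indexed by all of [nat], for use with [seqDU]. Past [k] it repeats the
    neighbourhood chosen at [point], which has the same properties. *)
Lemma local_homeo_cover : compact [set: Z] ->
  exists (k : nat) (U : nat -> set Z) (g : nat -> Z -> Z),
  [/\ forall i, open (U i), forall i, open (h @` U i),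
      forall i, {within h @` U i, continuous (g i)},
      forall i u, U i u -> g i (h u) = u &
      forall z, exists2 i, (i < k)%N & U i z].
Proof.
rewrite compact_cover => cZ.
have [V VP] := choice local_homeo_inverse.
have [g gP] := choice VP.
have [|x _|D _ Dcov] := cZ Z setT V; first by move=> x _; have [] := gP x.
  by exists x => //; have [] := gP x.
pose s := enum_fset D.
exists (size s), (V \o nth point s), (g \o nth point s); split.
- by move=> i; have [] := gP (nth point s i).
- by move=> i; have [] := gP (nth point s i).
- by move=> i; have [] := gP (nth point s i).
- by move=> i; have [] := gP (nth point s i).
move=> z; have [x xD Vxz] := Dcov z I.
by exists (index x s); rewrite ?index_mem//= nth_index.
Qed.

(* For disjoint [B i] on which [h] is injective, the fiber of [z] contains one
   point of [B i] when [z \in h @` B i] and none otherwise. *)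
Lemma fiber_sum_pieces (R : realType) (a : Z -> R) (k : nat) (B : nat -> set Z)
    (g : nat -> Z -> Z) (z : Z) :
  trivIset setT B -> (forall i u, B i u -> g i (h u) = u) ->
  (forall w, h w = z -> exists2 i, (i < k)%N & B i w) ->
  fiber_sum h a z = \sum_(i < k) (\1_(h @` B i) z * a (g i z)).
Proof.
move=> tB gh cov.
pose s := [seq g i z | i <- iota 0 k & z \in h @` B i].
have gB i : z \in h @` B i -> B i (g i z) /\ h (g i z) = z.
  by move/set_mem => [u Bu <-]; rewrite gh.
have us : uniq s.
  rewrite map_inj_in_uniq ?filter_uniq ?iota_uniq// => i j.
  rewrite !mem_filter => /andP[/gB[Bi _] _] /andP[/gB[Bj _] _] gij.
  apply: contrapT => /eqP ij; move/trivIsetP : tB => /(_ i j I I ij).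
  by rewrite -subset0 => /(_ (g i z)); apply; split => //; rewrite gij.
rewrite /fiber_sum (fsbigE s)//=.
- rewrite big_map big_filter_cond/= -(big_mkord xpredT
    (fun i => \1_(h @` B i) z * a (g i z))) /index_iota subn0.
  rewrite [LHS]big_mkcond/=; apply: eq_bigr => i _.
  rewrite indicE; case: ifPn.
    by move=> /andP[-> _]; rewrite mul1r.
  rewrite negb_and; case: (boolP (z \in h @` B i)) => /= [zB|]; last first.
    by rewrite mul0r.
  by have [_ hg] := gB _ zB; rewrite mem_set.
- move=> w /mapP[i]; rewrite mem_filter => /andP[/gB[_ hg] _] ->.
  exact: hg.
- move=> w hw /negP; case; have [i ik Bw] := cov w hw.
  apply/mapP; exists i; last by rewrite -hw gh.
  by rewrite mem_filter mem_iota/= ik andbT; apply/mem_set; exists w.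
Qed.

(** A member [U i] of the finite cover contains at most one point of the fiber, namely [g i z]. *)
Lemma fiber_finite (z : Z) : compact [set: Z] -> finite_set (h @^-1` [set z]).
Proof.
move=> /local_homeo_cover[k [U [g [_ _ _ gh cov]]]].
apply: (@sub_finite_set _ _ [set` [seq g i z | i <- iota 0 k]]).
  move=> w hw; have [i ik Uw] := cov w; apply/mapP; exists i.
    by rewrite mem_iota.
  by rewrite -hw gh.
exact: finite_seq.
Qed.

(* Disjoint neighbourhoods of the points of the fiber of [z] evenly cover a
   neighbourhood of [z]; the fibers near [z] contain no further point because
   [h] is a closed map. *)
Lemma fiber_sum_continuous (R : realType) (a : Z -> R) :
  hausdorff_space Z -> compact [set: Z] -> continuous a ->
  continuous (fiber_sum h a).
Proof.
move=> hZ cZ ca z.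
pose s : seq Z := enum_fset (fset_set (h @^-1` [set z])).
have us : uniq s by exact: fset_uniq.
have sP w : (w \in s) = (h w == z).
  rewrite /s in_fset_set; last exact: fiber_finite.
  by apply/idP/eqP => [/set_mem//|hw]; exact/mem_set.
have [W [nW tW]] := hausdorff_separate_finite s hZ.
have [V VP] := choice local_homeo_inverse.
have [g gP] := choice VP.
pose O w := (W w)° `&` V w.
have oO w : open (O w).
  by apply: openI; [exact: open_interior|have [] := gP w].
have Ow w : O w w.
  by split; [exact: nW|have [] := gP w].
(* Beyond the fiber [nth] would repeat its default; the empty set keeps the family disjoint over all
   of [nat]. *)
pose B i := if (i < size s)%N then O (nth point s i) else set0.
have tB : trivIset setT B.
  apply/trivIsetP => i j _ _ ij; rewrite /B.
  case: ifPn => [ik|_]; last by rewrite set0I.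
  case: ifPn => [jk|_]; last by rewrite setI0.
  rewrite -subset0 => x [[Wi _] [Wj _]].
  rewrite -(tW (nth point s i) (nth point s j)) ?mem_nth ?nth_uniq//.
  by split; exact: interior_subset.
pose G i := g (nth point s i).
have GB i u : B i u -> G i (h u) = u.
  rewrite /B; case: ifPn => // ik [_ Vu]; rewrite /G.
  by have [_ _ _ _] := gP (nth point s i); apply.
have near_cov : \forall y \near z, forall w, h w = y ->
    exists2 i, (i < size s)%N & B i w.
  have : \forall y \near z, h @^-1` [set y] `<=` \bigcup_i B i.
    apply: near_fiber_sub => //.
      apply: bigcup_open => i _; rewrite /B; case: ifPn => // _.
      exact: open0.
    move=> w hw; have ws : w \in s by rewrite sP hw.
    by exists (index w s) => //; rewrite /B index_mem ws nth_index.
  apply: filterS => y yB w hw; have [i _ Biw] := yB w hw; exists i => //.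
  by move: Biw; rewrite /B; case: ifPn.
have hs i : (i < size s)%N -> h (nth point s i) = z.
  by move=> ik; apply/eqP; rewrite -sP mem_nth.
(* Since [h] is open, every piece still meets the fibers near [z]. All indicators are then 1, and
   the fiber sum is locally a sum of a fixed number of terms, each continuous at [z]. *)
have near_im : \forall y \near z, forall i : 'I_(size s), (h @` B i) y.
  apply: filter_forall => i; rewrite -(hs i)//; apply: local_homeo_open.
  by rewrite /B ltn_ord; apply: open_nbhs_nbhs.
have E : \forall y \near z,
    fiber_sum h a y = \sum_(i < size s) a (G i y).
  near=> y; rewrite (@fiber_sum_pieces R a (size s) B G)//.
    apply: eq_bigr => i _; rewrite indicE mem_set ?mul1r//.
    by move: i; near: y.
  by near: y.
rewrite /continuous_at (nbhs_singleton E).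
apply: (@cvg_trans _ ((fun y => \sum_(i < size s) a (G i y)) @ z)).
  by apply: near_eq_cvg; apply: filterS E => y ->.
apply: cvg_sumr => i.
apply: continuous_comp; last exact: ca.
have [_ Vi ohV + _] := gP (nth point s i).
rewrite (continuous_open_subspace _ ohV); apply.
by apply/mem_set; exists (nth point s i) => //; exact: hs.
Unshelve. all: by end_near.
Qed.

End LocalHomeomorphism.

(** * Counting the points of the fibers *)

Section CountingFibers.
Context (Z : ptopologicalType) (h : Z -> Z).
Hypotheses (hZ : hausdorff_space Z) (cZ : compact [set: Z]).
Hypothesis h_lh : local_homeomorphism h.

Lemma fiberS (n : nat) (z : Z) :
  fiber h n.+1 z = \bigcup_(w in h @^-1` [set z]) fiber h n w.
Proof.
apply/seteqP; split=> [x /= xz|x [w /= wz xw]].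
  by exists (iter n h x).
by have <- : h w = z := wz; have <- : iter n h x = w := xw.
Qed.

Lemma iter_fiber_finite (n : nat) (z : Z) : finite_set (fiber h n z).
Proof.
elim: n z => [|n IHn] z; first exact: finite_set1.
by rewrite fiberS; apply: bigcup_finite => //; exact: fiber_finite.
Qed.

Lemma card_fiber_fsum (R : realType) (n : nat) (z : Z) :
  (card_fiber h n z)%:R = \sum_(x \in fiber h n z) (1 : R).
Proof.
rewrite fsbig_finite//=; last exact: iter_fiber_finite.
by rewrite big_const_seq count_predT iter_addr_0.
Qed.

Lemma card_fiber0 (z : Z) : card_fiber h 0 z = 1%N.
Proof.
rewrite /card_fiber (_ : fiber h 0 z = [set z])// fset_set1.
exact: cardfs1.
Qed.

(** Double counting: a point [x] of the larger fiber is counted at the single [w = iter n h x]. The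
    continuity of the counting functions follows by iteration. *)
Lemma card_fiberS (R : realType) (n : nat) (z : Z) :
  (card_fiber h n.+1 z)%:R =
  fiber_sum h (fun w => (card_fiber h n w)%:R : R) z.
Proof.
have fz := fiber_finite h_lh z cZ; have fn := iter_fiber_finite n.+1 z.
transitivity (\sum_(w \in h @^-1` [set z]) \sum_(x \in fiber h n.+1 z)
    (\1_[set x | iter n h x = w] x : R)).
  rewrite exchange_fsbig// card_fiber_fsum; apply: eq_fsbigr => x /set_mem xz.
  rewrite (fsbigD1 (iter n h x))//= indicE mem_set// fsbig1 ?addr0//.
  by move=> w [_ /= wx]; rewrite indicE memNset// => /esym.
apply: eq_fsbigr => w /set_mem /= wz; rewrite card_fiber_fsum.
transitivity (\sum_(x \in fiber h n w) (\1_[set x | iter n h x = w] x : R)).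
  apply/esym/fsbig_widen; first by rewrite fiberS => x xw; exists w.
  by move=> x [_ /= xw]; rewrite indicE memNset.
by apply: eq_fsbigr => x /set_mem xw; rewrite indicE mem_set.
Qed.

Lemma card_fiber_continuous (R : realType) (n : nat) :
  continuous (fun z => (card_fiber h n z)%:R : R).
Proof.
elim: n => [|n IHn].
  by under eq_fun do rewrite card_fiber0; exact: cst_continuous.
under eq_fun do rewrite card_fiberS; exact: fiber_sum_continuous.
Qed.

(** The counting function, read in [R], is continuous on a compact space and attains its maximum;
    hence the [xget] in [max_card_fiber] does not fall back on its default. *)
Lemma card_fiber_max (R : realType) (n : nat) (z : Z) :
  (card_fiber h n z <= max_card_fiber h n)%N.
Proof.
have [||c _ cmax] := @compact_EVT_max Z R
    (fun z => (card_fiber h n z)%:R) setT _ cZ.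
- by exists z.
- by apply: continuous_subspaceT; exact: card_fiber_continuous.
rewrite /max_card_fiber; case: xgetP => [m _ [_]//|/(_ (card_fiber h n c))].
case; split; first by exists c.
by move=> y; rewrite -(ler_nat R); apply: cmax; rewrite inE.
Qed.

End CountingFibers.

Section FiberSums.
Context (Z : ptopologicalType) (h : Z -> Z).
Hypotheses (cZ : compact [set: Z]) (h_lh : local_homeomorphism h).

Lemma fiber_sumE (R : realType) (a : Z -> R) (z : Z) :
  fiber_sum h a z = \sum_(w <- enum_fset (fset_set (h @^-1` [set z]))) a w.
Proof. by apply: fsbig_finite; exact: fiber_finite. Qed.

Lemma fiber_sumB (R : realType) (a b : Z -> R) :
  fiber_sum h (fun z => a z - b z) =
  fun z => fiber_sum h a z - fiber_sum h b z.
Proof. by apply/funext => z; rewrite !fiber_sumE sumrB. Qed.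

Lemma fiber_sumZ (R : realType) (r : R) (a : Z -> R) :
  fiber_sum h (fun z => r * a z) = fun z => r * fiber_sum h a z.
Proof. by apply/funext => z; rewrite !fiber_sumE mulr_sumr. Qed.

Lemma fiber_sum_sum (R : realType) (n : nat) (a : nat -> Z -> R) (z : Z) :
  fiber_sum h (fun w => \sum_(i < n) a i w) z =
  \sum_(i < n) fiber_sum h (a i) z.
Proof.
rewrite fiber_sumE exchange_big; apply: eq_bigr => i _.
by rewrite fiber_sumE.
Qed.

Lemma fiber_sum_cvg (R : realType) (a : nat -> Z -> R) (b : Z -> R) (z : Z) :
  (forall w, a n w @[n --> \oo] --> b w) ->
  fiber_sum h (a n) z @[n --> \oo] --> fiber_sum h b z.
Proof.
move=> ab; under eq_fun do rewrite fiber_sumE; rewrite fiber_sumE.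
exact: cvg_sumr.
Qed.

End FiberSums.

(** * Summability above the critical growth rate *)

(** Root test: the strict inequality leaves room for a real [b < beta] that eventually bounds the
    exponential growth rates, and the terms are then dominated by a geometric series of ratio
    [expR (b - beta)]. *)
Lemma max_card_fiber_summable (R : realType) (Z : ptopologicalType)
    (h : Z -> Z) (beta : R) : (beta_c R h < beta%:E)%E ->
  cvgn (series (fun n => expR (- beta * n%:R) * (max_card_fiber h n)%:R)).
Proof.
rewrite /beta_c /limn_esup /limf_esup => /ereal_inf_lt[_ [V oV <-]] supV.
have [b bV bbeta] : exists2 b : R, (forall n, V n ->
    n%:R^-1 * ln ((max_card_fiber h n)%:R : R) <= b) & b < beta.
  set s := ereal_sup _ in supV.
  have sV n : V n -> ((n%:R^-1 * ln ((max_card_fiber h n)%:R : R))%:E <= s)%E.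
    by move=> Vn; apply: ereal_sup_ubound; exists n.
  move: s supV sV => [s||] // sb sV.
    by exists s; [move=> n /sV; rewrite lee_fin|rewrite -lte_fin].
  (* A supremum equal to [-oo] contradicts any [V n], so every real below [beta] serves. *)
  exists (beta - 1); last by rewrite ltrBlDr ltrDl.
  by move=> n /sV; rewrite leeNy_eq.
set u := fun n : nat => _.
have u0 n : 0 <= u n by rewrite mulr_ge0 ?expR_ge0.
pose q := expR (b - beta).
have q1 : `|q| < 1 by rewrite ger0_norm ?expR_ge0// expR_lt1 subr_lt0.
case: oV => N _ NV.
(* Starting at [N.+1] excludes [n = 0], where the factor [n%:R^-1] is 0 and the bound on the
   logarithm carries no information. *)
have uq n : (N.+1 <= n)%N -> u n <= q ^+ n.
  move=> Nn; have n0 : (0 < n)%N by exact: leq_ltn_trans Nn.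
  rewrite /u /q -expRM_natr mulrBl expRD mulrC mulNr ler_wpM2r ?expR_ge0//.
  (* The logarithm can be inverted only at positive arguments, so a zero maximum is treated
     apart. *)
  have [->|M0] := posnP (max_card_fiber h n); first exact: expR_ge0.
  rewrite -ler_ln ?posrE ?expR_gt0 ?ltr0n// expRK -ler_pdivrMr ?ltr0n//.
  by rewrite mulrC; apply/bV/NV/ltnW.
have tl (w : nat -> R) :
    cvgn [sequence \sum_(N.+1 <= k < n) w k]_n = cvgn (series w).
  exact: is_cvg_series_restrict.
suff : cvgn [sequence \sum_(N.+1 <= k < n) u k]_n by rewrite tl => cu; exact: cu.
have cq : cvgn (series (fun n => q ^+ n)).
  have <- : geometric 1 q = (fun n => q ^+ n).
    by apply/funext => n; rewrite /geometric/= mul1r.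
  exact: is_cvg_geometric_series.
have : cvgn (series (fun n => if (n < N.+1)%N then 0 else u n)).
  apply: (@series_le_cvg _ _ (fun n => q ^+ n)).
  - by move=> n; case: ifP.
  - by move=> n; rewrite exprn_ge0 ?expR_ge0.
  - move=> n; case: ltnP => [_|/uq//]; by rewrite exprn_ge0 ?expR_ge0.
  - exact: cq.
rewrite -tl; set v := [sequence _]_n; suff <- : v = [sequence \sum_(N.+1 <= k < n) u k]_n.
  by [].
apply/funext => n.
by apply: eq_big_nat => k /andP[Nk _]; rewrite ltnNge Nk.
Qed.

(** * Regular measures *)

(** An alias of [mu] that carries the proof of finiteness, so that the finite measure structure can
    be attached to a variable measure. *)
Definition finite_measure_of d (T : measurableType d) (R : realType)
  (mu : {measure set T -> \bar R}) & (mu setT < +oo)%E : set T -> \bar R := mu.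

Section FiniteMeasureOf.
Context d (T : measurableType d) (R : realType).
Variables (mu : {measure set T -> \bar R}) (muoo : (mu setT < +oo)%E).

HB.instance Definition _ := Measure.on (finite_measure_of muoo).

HB.instance Definition _ :=
  Measure_isFinite.Build d T R (finite_measure_of muoo) (lty_fin_num_fun muoo).

End FiniteMeasureOf.

Section RegularMeasures.
Context (R : realType) (Z : ptopologicalType).
Hypotheses (hZ : hausdorff_space Z) (cZ : compact [set: Z]).
Implicit Types (mu nu : regular_measure R Z) (a b : Z -> R).

Lemma open_measurable_borel (U : set (borelType Z)) :
  open (U : set Z) -> measurable U.
Proof. exact: sub_sigma_algebra. Qed.

Lemma compact_measurable_borel (K : set (borelType Z)) :
  compact (K : set Z) -> measurable K.
Proof.
move=> /(compact_closed hZ) clK; rewrite -(setCK K); apply: measurableC.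
by apply: open_measurable_borel; exact: closed_openC.
Qed.

Lemma finite_measure_integrable_continuous
    (mu : {finite_measure set (borelType Z) -> \bar R}) a :
  continuous a -> mu.-integrable setT (EFin \o a).
Proof.
move=> ca; apply: measurable_bounded_integrable => //.
- by rewrite ltey_eq fin_num_measure.
- exact: continuous_measurable_real.
- have [M _ aM] := compact_continuous_bounded cZ ca.
  exists M; split; first exact: num_real.
  by move=> y My z _; exact: le_trans (aM z) (ltW My).
Qed.

Lemma integ_EFin mu a : continuous a ->
  (integ mu a)%:E = (\int[mu]_z (a z)%:E)%E.
Proof.
move=> ca; rewrite /integ /Rintegral fineK//; apply: integrable_fin_num => //.
exact: finite_measure_integrable_continuous.
Qed.

Lemma integD mu a b : continuous a -> continuous b ->
  integ mu (fun z => a z + b z) = integ mu a + integ mu b.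
Proof.
by move=> ca cb; apply: RintegralD => //; exact: finite_measure_integrable_continuous.
Qed.

Lemma integB mu a b : continuous a -> continuous b ->
  integ mu (fun z => a z - b z) = integ mu a - integ mu b.
Proof.
by move=> ca cb; apply: RintegralB => //; exact: finite_measure_integrable_continuous.
Qed.

Lemma integZ mu (r : R) a : continuous a ->
  integ mu (fun z => r * a z) = r * integ mu a.
Proof.
by move=> ca; apply: RintegralZl => //; exact: finite_measure_integrable_continuous.
Qed.

Lemma integ_cst mu (r : R) : integ mu (fun=> r) = r * integ mu (fun=> 1).
Proof. by rewrite -integZ ?mulr1//; exact: cst_continuous. Qed.

Lemma integ_cst1 mu : (integ mu (fun=> 1))%:E = mu setT.
Proof. by rewrite integ_EFin ?integral_cst ?mul1e//; exact: cst_continuous. Qed.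

Lemma integ_ge0 mu a : (forall z, 0 <= a z) -> 0 <= integ mu a.
Proof. by move=> a0; apply: Rintegral_ge0. Qed.

Lemma le_integ mu a b : continuous a -> continuous b ->
  (forall z, a z <= b z) -> integ mu a <= integ mu b.
Proof.
move=> ca cb ab; apply: le_Rintegral => //; exact: finite_measure_integrable_continuous.
Qed.

Lemma integ_norm_le mu a (M : R) : continuous a -> (forall z, `|a z| <= M) ->
  `|integ mu a| <= M * integ mu (fun=> 1).
Proof.
move=> ca aM; rewrite ler_norml -mulNr -!integ_cst.
apply/andP; split; apply: le_integ => //; try exact: cst_continuous.
  by move=> z; have := aM z; rewrite ler_norml => /andP[].
by move=> z; have := aM z; rewrite ler_norml => /andP[].
Qed.

(** Integral identities are obtained first for nonnegative functions, where integrals against sums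
    of measures split freely; this shift extends them to all continuous functions by linearity. *)
Lemma continuous_nonneg_shift a : continuous a ->
  exists (M : R) (b : Z -> R),
    [/\ 0 <= M, continuous b, forall z, 0 <= b z & a = fun z => b z - M].
Proof.
move=> ca; have [M M0 aM] := compact_continuous_bounded cZ ca.
exists M, (fun z => a z + M); split.
- exact: ltW.
- by move=> z; apply: cvgD; [exact: ca|exact: cvg_cst].
- by move=> z; rewrite -lerBlDr sub0r; have := aM z; rewrite ler_norml => /andP[].
- by apply/funext => z; rewrite addrK.
Qed.

(** Outer regularity for finite measures, with the excess written as a mass rather than a difference
    of masses: this makes it monotone in [mu]. It is stated for bare set functions, so that it
    applies before finiteness is bundled. *)
Definition outer_approximable (mu : set (borelType Z) -> \bar R) :=
  forall E : set (borelType Z), measurable E -> forall e : R, 0 < e ->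
  exists U : set Z, [/\ open U, E `<=` U & (mu (U `\` E) <= e%:E)%E].

Lemma regular_outer_approximable
    (mu : {finite_measure set (borelType Z) -> \bar R}) :
  regular mu -> outer_approximable mu.
Proof.
move=> rmu E mE e e0; have [muE _] := rmu E mE.
have fE : mu E \is a fin_num by exact: fin_num_measure.
have : (ereal_inf [set mu U | U in [set U : set Z | open U /\ E `<=` U]]
    < mu E + e%:E)%E by rewrite -muE lteDl.
move=> /ereal_inf_lt[_ [U [oU EU] <-] Ue]; exists U; split => //.
have mU := open_measurable_borel oU.
rewrite measureD//; last by rewrite ltey_eq fin_num_measure.
by rewrite setIidr// leeBlDl// ltW.
Qed.

(** Inner regularity comes from approximating the complement of [E] from outside by [U]: the
    complement of [U] is a compact subset of [E], and the part of [E] that is lost is the excess of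
    [U]. *)
Lemma outer_approximable_regular
    (mu : {finite_measure set (borelType Z) -> \bar R}) :
  outer_approximable mu -> regular mu.
Proof.
move=> amu E mE; have fE F : measurable F -> mu F \is a fin_num.
  by move=> mF; exact: fin_num_measure.
split; apply/eqP; rewrite eq_le; apply/andP; split.
- apply: le_ereal_inf_tmp => _ [U [oU EU] <-].
  by apply: le_measure; rewrite ?inE//; exact: open_measurable_borel.
- apply/lee_addgt0Pr => e e0; have [U [oU EU Ue]] := amu E mE e e0.
  apply: (@le_trans _ _ (mu U)); first by apply: ereal_inf_lbound; exists U.
  have mU := open_measurable_borel oU.
  rewrite (measureDI mu mU mE) setIidr// addeC; exact: leeD2l.
- apply/lee_addgt0Pr => e e0.
  have [U [oU EU Ue]] := amu _ (measurableC mE) e e0.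
  have mU := open_measurable_borel oU.
  rewrite (measureDI mu mE mU); apply: leeD.
    apply: ereal_sup_ubound; exists (E `\` U) => //; split => //.
    rewrite (_ : E `\` U = ~` U).
      by apply: (subclosed_compact _ cZ) => //; exact: open_closedC.
    apply/seteqP; split=> [x []//|x nUx]; split=> //.
    by apply: contrapT => /EU.
  by move: Ue; rewrite setDE setCK setIC.
- apply: ge_ereal_sup => _ [K [cK KE] <-].
  by apply: le_measure; rewrite ?inE//; exact: compact_measurable_borel.
Qed.

Lemma regular_measure_of
    (mu : {measure set (borelType Z) -> \bar R}) :
  (mu setT < +oo)%E -> outer_approximable mu ->
  exists nu : regular_measure R Z, forall E : set (borelType Z), measurable E -> nu E = mu E.
Proof.
move=> muoo amu.
pose m : {finite_measure set (borelType Z) -> \bar R} := finite_measure_of muoo.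
have rm : regular m by exact: outer_approximable_regular.
by exists (RegularMeasure rm).
Qed.

(* Urysohn functions between compact [K] and open [U] transfer the inequality
   to [mu K <= c * nu U]; regularity does the rest. *)
Lemma integral_domination mu nu (c : R) : 0 <= c ->
  (forall a, continuous a -> (forall z, 0 <= a z) ->
    integ mu a <= c * integ nu a) ->
  forall E : set (borelType Z), measurable E -> (mu E <= c%:E * nu E)%E.
Proof.
move=> c0 le_c E mE; have [_ ->] := measure_of_regular mu mE.
apply: ge_ereal_sup => _ [K [cK KE] <-]; apply/lee_addgt0Pr => e e0.
(* Dividing by [c + 1] keeps the tolerance meaningful when [c = 0], and [c * (e / (c + 1)) <= e]. *)
have c1 : 0 < c + 1 by rewrite ltr_wpDl.
have [U [oU EU Ue]] := regular_outer_approximable (measure_of_regular nu) mE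
  (divr_gt0 e0 c1).
have mU := open_measurable_borel oU.
have mK := compact_measurable_borel cK.
have [||||a [ca aU aK arange]] :=
  @urysohn_ext_itv Z R (compact_normal hZ cZ) (~` U) K 0 1.
- exact: open_closedC.
- exact: compact_closed.
- by rewrite -subset0 => z [nUz /KE/EU].
- exact: ltr01.
have a0 z : 0 <= a z.
  have : range a (a z) by exists z.
  by move/arange; rewrite /= in_itv/= => /andP[].
have a1 z : a z <= 1.
  have : range a (a z) by exists z.
  by move/arange; rewrite /= in_itv/= => /andP[].
have ma : measurable_fun setT (fun z : borelType Z => (a z)%:E).
  by apply/measurable_EFinP; exact: continuous_measurable_real.
have muK : (mu K <= (integ mu a)%:E)%E.
  rewrite integ_EFin// -(setIT K) -integral_indic//; apply: ge0_le_integral => //.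
  - exact/measurable_EFinP/measurable_indic.
  - move=> z _; rewrite lee_fin indicE; case: (boolP (z \in K)) => // /set_mem Kz.
    by have -> : a z = 1 by apply: aK; exists z.
have nuU : ((integ nu a)%:E <= nu U)%E.
  rewrite integ_EFin// -(setIT U) -integral_indic//; apply: ge0_le_integral => //.
  - by move=> z _; rewrite lee_fin.
  - exact/measurable_EFinP/measurable_indic.
  - move=> z _; rewrite lee_fin indicE; case: (boolP (z \in U)) => // /negP nUz.
    by have -> : a z = 0 by apply: aU; exists z => // Uz; exact/nUz/mem_set.
apply: (le_trans muK); apply: (@le_trans _ _ (c%:E * nu U)%E).
  apply: (@le_trans _ _ (c * integ nu a)%:E); first by rewrite lee_fin le_c.
  by rewrite EFinM; apply: lee_wpmul2l.
rewrite (measureDI nu mU mE) setIidr// addeC muleDr//; last first.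
  by rewrite ge0_adde_def// inE.
apply: leeD2l; apply: (@le_trans _ _ (c%:E * (e / (c + 1))%:E)%E).
  by apply: lee_wpmul2l.
rewrite -EFinM lee_fin mulrCA ler_piMr ?(ltW e0)//.
by rewrite ler_pdivrMr// mul1r lerDl.
Qed.

(** Domination with constant 1, in both directions. *)
Lemma regular_measure_integ_inj mu nu :
  (forall a, continuous a -> integ mu a = integ nu a) ->
  forall E : set (borelType Z), measurable E -> mu E = nu E.
Proof.
move=> eq_mn E mE; apply/eqP; rewrite eq_le.
by apply/andP; split; rewrite -[leRHS]mul1e; apply: integral_domination => //
  a ca _; rewrite mul1r eq_mn.
Qed.

End RegularMeasures.

(** * Differences and series of regular measures *)

Section MeasureConstructions.
Context (R : realType) (Z : ptopologicalType).
Hypotheses (hZ : hausdorff_space Z) (cZ : compact [set: Z]).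
Implicit Types (mu nu eps : regular_measure R Z).

Lemma integ_sub_nonneg mu nu eps (c : R) :
  (forall a : Z -> R, continuous a -> (forall z, 0 <= a z) ->
    integ eps a = integ mu a - c * integ nu a) ->
  forall a : Z -> R, continuous a -> integ eps a = integ mu a - c * integ nu a.
Proof.
move=> H a ca; have [M [b [M0 cb b0 ->]]] := continuous_nonneg_shift cZ ca.
have cM : continuous (fun _ : Z => M : R) by exact: cst_continuous.
rewrite !integB// !H//; ring.
Qed.

Lemma regular_measure_sub mu nu (c : R) : 0 <= c ->
  (forall E : set (borelType Z), measurable E -> (c%:E * nu E <= mu E)%E) ->
  exists eps : regular_measure R Z,
    (forall E : set (borelType Z), measurable E ->
      eps E = (mu E - c%:E * nu E)%E) /\
    (forall a : Z -> R, continuous a -> integ eps a = integ mu a - c * integ nu a).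
Proof.
move=> c0 nu_mu.
pose D : {charge set (borelType Z) -> \bar R} :=
  cadd (charge_of_finite_measure mu)
       (cscale (- c) (charge_of_finite_measure nu)).
(* Subtraction is available for charges. The restriction that follows sets the value to 0 off the
   measurable sets, because [measure_of_charge] asks for nonnegativity on every set and [nu_mu]
   gives it only on measurable ones. *)
have DE E : D E = (mu E - c%:E * nu E)%E.
  by rewrite /D/= /cadd/= /cscale/= /charge_of_finite_measure EFinN mulNe.
pose Dr : {charge set (borelType Z) -> \bar R} :=
  crestr0 D (@measurableT _ (borelType Z)).
have DrE E : measurable E -> Dr E = (mu E - c%:E * nu E)%E.
  by move=> mE; rewrite /Dr /= /crestr0 mem_set// /crestr setIT DE.
have Dr0 E : (0 <= Dr E)%E.
  have [mE|nE] := pselect (measurable E).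
    rewrite DrE// sube_ge0 ?nu_mu//; apply/orP; right; exact: fin_num_measure.
  by rewrite /Dr /= /crestr0 memNset.
have [||eps epsE] := @regular_measure_of R Z hZ cZ (measure_of_charge Dr Dr0).
- by rewrite ltey_eq; apply/orP; left; exact: (@fin_num_measure _ _ _ Dr).
- move=> E mE e e0.
  have [U [oU EU Ue]] :=
    regular_outer_approximable (measure_of_regular mu) mE e0.
  exists U; split => //; apply: le_trans Ue.
  have mUE : measurable (U `\` E : set (borelType Z)).
    by apply: measurableD => //; exact: open_measurable_borel.
  have := DrE _ mUE; rewrite /Dr /= /measure_of_charge => ->.
  by rewrite geeDl// oppe_le0 mule_ge0.
have epsE' E : measurable E -> eps E = (mu E - c%:E * nu E)%E.
  by move=> mE; rewrite epsE//; exact: DrE.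
exists eps; split => //; apply: integ_sub_nonneg => a ca a0.
have ma : measurable_fun setT (fun z : borelType Z => (a z)%:E).
  by apply/measurable_EFinP; exact: continuous_measurable_real.
(* The identity is read as [mu = eps + c nu], which involves only nonnegative integrals against sums
   of measures. *)
apply/eqP; rewrite eq_sym subr_eq; apply/eqP/EFin_inj.
rewrite EFinD EFinM !integ_EFin//.
rewrite (@eq_measure_integral _ _ _ _
  (measure_add eps (mscale (NngNum c0) nu))); last first.
  move=> A mA _; transitivity (eps A + mscale (NngNum c0) nu A)%E.
    by rewrite /mscale/= epsE' // subeK// fin_numM// fin_num_measure.
  exact/esym/measure_addE.
rewrite ge0_integral_measure_add// ?ge0_integral_mscale//.
all: by move=> z _; rewrite lee_fin.
Qed.

Lemma nneseries_EFin (u : nat -> R) : cvgn (series u) ->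
  (\sum_(0 <= n <oo) (u n)%:E)%E = (limn (series u))%:E.
Proof.
move=> cu; apply/cvg_lim => //.
rewrite (_ : (fun n => _) = EFin \o series u); last first.
  by apply/funext => n; rewrite /= /series/= sumEFin.
by apply: cvg_EFin; [exact: nearW|exact: cu].
Qed.

Lemma outer_approximable_finite (m : nat -> {measure set (borelType Z) -> \bar R})
    (N : nat) (E : set (borelType Z)) (e : R) :
  (forall n, outer_approximable (m n)) -> measurable E -> 0 < e ->
  exists U : set Z, [/\ open U, E `<=` U &
    forall n, (n < N)%N -> (m n (U `\` E) <= e%:E)%E].
Proof.
move=> am mE e0; elim: N => [|N [U [oU EU Ue]]].
  by exists setT; split => //; exact: openT.
have [V [oV EV Ve]] := am N E mE e e0.
have mU := open_measurable_borel oU; have mV := open_measurable_borel oV.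
exists (U `&` V); split; first exact: openI.
  by move=> x Ex; split; [exact: EU|exact: EV].
have sub (W : set (borelType Z)) n : measurable W -> U `&` V `<=` W ->
    (m n (W `\` E) <= e%:E)%E -> (m n ((U `&` V) `\` E) <= e%:E)%E.
  move=> mW UVW We; apply: le_trans We; apply: le_measure.
  - by rewrite inE; apply: measurableD => //; exact: measurableI.
  - by rewrite inE; exact: measurableD.
  - exact: setSD.
move=> n; rewrite ltnS leq_eqVlt => /predU1P[->|nN].
  by apply: (sub V) => // x [].
by apply: (sub U) => [//|x []//|]; exact: Ue.
Qed.

Lemma outer_approximable_scale (c : {nonneg R}) mu :
  outer_approximable (mscale c mu).
Proof.
move=> E mE e e0; have c1 : 0 < c%:num + 1 by rewrite ltr_wpDl.
have [U [oU EU Ue]] := regular_outer_approximable (measure_of_regular mu) mE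
  (divr_gt0 e0 c1).
exists U; split => //; rewrite /mscale/=.
apply: (@le_trans _ _ (c%:num%:E * (e / (c%:num + 1))%:E)%E).
  by apply: lee_wpmul2l; rewrite ?lee_fin.
rewrite -EFinM lee_fin mulrCA ler_piMr ?(ltW e0)//.
by rewrite ler_pdivrMr// mul1r lerDl.
Qed.

(* Regularity: all but finitely many terms are below [e / 2] in total mass, and
   finitely many terms share one open neighbourhood of [E]. *)
Lemma regular_measure_series (nu : nat -> regular_measure R Z) (c : nat -> R) :
  (forall n, 0 <= c n) ->
  cvgn (series (fun n => c n * integ (nu n) (fun=> 1))) ->
  exists mu : regular_measure R Z, forall a : Z -> R, continuous a ->
    series (fun n => c n * integ (nu n) a) @ \oo --> integ mu a.
Proof.
move=> c0 cvg1.
pose m n : {measure set (borelType Z) -> \bar R} := mscale (NngNum (c0 n)) (nu n).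
pose M := mseries m 0.
have mT n : m n setT = (c n * integ (nu n) (fun=> 1))%:E.
  by rewrite /m /mscale/= EFinM integ_cst1.
have MT : (\sum_(0 <= n <oo) m n setT < +oo)%E.
  by under eq_eseriesr do rewrite mT; rewrite nneseries_EFin// ltry.
have [||mu muE] := @regular_measure_of R Z hZ cZ M.
- exact: MT.
- move=> E mE e e0.
  have := nneseries_tail_cvg MT (fun n _ => measure_ge0 (m n) setT).
  have e20 : (0 < (e / 2)%:E)%E by rewrite lte_fin divr_gt0.
  have : nbhs (0 : \bar R) [set x | (x < (e / 2)%:E)%E].
    by apply: open_nbhs_nbhs; split => //; exact: open_ereal_lt_ereal.
  move=> /[swap] /[apply] -[N _ /(_ N (leqnn N)) /= tailN].
  (* The [N] head terms share [e / 2]; [N.+1] keeps the denominator nonzero when [N = 0]. *)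
  have eN0 : 0 < e / 2 / N.+1%:R by rewrite !divr_gt0.
  have [U [oU EU Ue]] := outer_approximable_finite N
    (fun n => outer_approximable_scale (NngNum (c0 n)) (nu n)) mE eN0.
  have mUE : measurable (U `\` E : set (borelType Z)).
    by apply: measurableD => //; exact: open_measurable_borel.
  exists U; split => //.
  rewrite /M /mseries (nneseries_split 0 N)// add0n.
  rewrite [e]splitr EFinD; apply: leeD.
    apply: (@le_trans _ _ (\sum_(0 <= n < N) (e / 2 / N.+1%:R)%:E)%E).
      by rewrite !big_mkord; apply: lee_sum => i _; exact: Ue.
    rewrite sumEFin lee_fin sumr_const_nat subn0 -[leLHS]mulr_natr -[leLHS]mulrA ler_piMr//.
      by rewrite divr_ge0// ltW.
    by rewrite mulrC ler_pdivrMr// mul1r ler_nat.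
  apply: le_trans (ltW tailN); apply: lee_nneseries => // n _.
  by apply: le_measure; rewrite ?inE.
exists mu => a ca; have cvg_ge0 (b : Z -> R) : continuous b -> (forall z, 0 <= b z) ->
    series (fun n => c n * integ (nu n) b) @ \oo --> integ mu b.
  move=> cb b0.
  have mb : measurable_fun setT (fun z : borelType Z => (b z)%:E).
    by apply/measurable_EFinP; exact: continuous_measurable_real.
  have bE z : [set: borelType Z] z -> (0 <= (b z)%:E)%E by rewrite lee_fin.
  have E : (integ mu b)%:E =
      (\sum_(0 <= n <oo) (c n * integ (nu n) b)%:E)%E.
    rewrite integ_EFin// (@eq_measure_integral _ _ _ _ M); last first.
      by move=> A mA _; exact: muE.
    rewrite ge0_integral_measure_series//; apply: eq_eseriesr => n _.
    by rewrite ge0_integral_mscale// EFinM integ_EFin.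
  suff : EFin \o series (fun n => c n * integ (nu n) b) @ \oo -->
      (integ mu b)%:E by move/fine_cvg.
  rewrite E (_ : EFin \o _ = fun N =>
    (\sum_(0 <= n < N) (c n * integ (nu n) b)%:E)%E); last first.
    by apply/funext => n; rewrite /= /series/= sumEFin.
  apply: is_cvg_nneseries => n _ _; rewrite lee_fin mulr_ge0//.
  exact: integ_ge0.
have [K [b [K0 cb b0 ->]]] := continuous_nonneg_shift cZ ca.
have c1 : continuous (fun _ : Z => 1 : R) by exact: cst_continuous.
have cK : continuous (fun _ : Z => K : R) by exact: cst_continuous.
rewrite integB// integ_cst//.
rewrite (_ : series _ = fun N => series (fun n => c n * integ (nu n) b) N
  - K * series (fun n => c n * integ (nu n) (fun=> 1)) N).
  apply: cvgB; first exact: cvg_ge0.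
  by apply: cvgM; [exact: cvg_cst|exact: cvg_ge0].
apply/funext => N; rewrite /series/= mulr_sumr -sumrB; apply: eq_bigr => n _.
by rewrite integB// (integ_cst _ _ K)//; ring.
Qed.

End MeasureConstructions.

(** * The transfer operator *)

(** The complement of [D] is null for the restricted measure, which agrees with [m] inside [D]; this
    gives the indicator in the integral formula. The existential form lets [choice] produce a whole
    family. *)
Lemma restricted_pushforward d d' (X : measurableType d)
    (Y : measurableType d') (R : realType) (m : {measure set X -> \bar R})
    (phi : X -> Y) (D : set X) :
  measurable_fun setT phi -> measurable D ->
  exists p : {measure set Y -> \bar R},
    (forall E, p E = m (phi @^-1` E `&` D)) /\
    (forall f : Y -> \bar R, measurable_fun setT f ->
      (forall y, 0 <= f y)%E ->
      (\int[p]_y f y = \int[m]_x ((\1_D x)%:E * f (phi x)))%E).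
Proof.
move=> mphi mD.
pose p := measure_function_pushforward__canonical__measure_function_Measure
  (mrestr m mD) mphi.
exists p; split=> // f mf f0.
transitivity (\int[mrestr m mD]_x f (phi x))%E.
  by rewrite ge0_integral_pushforward// preimage_setT.
have mfphi : measurable_fun setT (f \o phi) by exact: measurableT_comp.
have N0 : mrestr m mD (~` D) = 0%E by rewrite /mrestr setICl measure0.
have mDC : measurable (~` D) by exact: measurableC.
have fphi0 x : [set: X] x -> (0 <= (f \o phi) x)%E by move=> _; exact: f0.
rewrite (ge0_negligible_integral mDC measurableT mfphi fphi0 N0).
rewrite setDE setTI setCK.
rewrite (@eq_measure_integral _ _ _ _ m); last first.
  by move=> A mA AD; rewrite /= /mrestr setIidl.
rewrite integral_mkcond; apply: eq_integral => x _.
by rewrite /patch indicE; case: ifP => _; rewrite ?mul1e ?mul0e.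
Qed.

Section Transfer.
Context (R : realType) (Z : ptopologicalType) (h : Z -> Z).
Hypotheses (hZ : hausdorff_space Z) (cZ : compact [set: Z]).
Hypothesis h_lh : local_homeomorphism h.
Implicit Types (mu nu : regular_measure R Z).

(* With disjoint Borel pieces [B i] on which [h] has inverse [g i], the measure
   is the sum over [i] of the pushforwards by [g i] of [nu] restricted to
   [h @` B i]. *)
Lemma transfer_exists nu : exists mu : regular_measure R Z,
  forall a : Z -> R, continuous a -> integ mu a = integ nu (fiber_sum h a).
Proof.
have [k [U [g [oU ohU cg gh cov]]]] := local_homeo_cover h_lh cZ.
pose B := seqDU U.
have BU i : B i `<=` U i by exact: subset_seqDU.
have tB : trivIset setT B by exact: trivIset_seqDU.
have covB w : exists2 i, (i < k)%N & B i w.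
  have : (\big[setU/set0]_(i < k) B i) w.
    rewrite -bigsetU_seqDU -bigcup_mkord.
    by have [i ik Uw] := cov w; exists i.
  by rewrite -bigcup_mkord => -[i ik Bw]; exists i.
have mU i : measurable (U i : set (borelType Z)).
  exact: open_measurable_borel.
have mhU i : measurable (h @` U i : set (borelType Z)).
  exact: open_measurable_borel.
have mB i : measurable (B i : set (borelType Z)) by exact: seqDU_measurable.
(* Inside [U i], direct images under [h] are preimages under the inverse branch, hence Borel for
   Borel sets. *)
have img i (F : set Z) : F `<=` U i -> h @` F = h @` U i `&` g i @^-1` F.
  move=> FU; apply/seteqP; split=> [_ [u Fu <-]|_ [[u Uu <-]]] /=.
    by split; [exists u => //; exact: FU|rewrite gh//; exact: FU].
  by rewrite gh// => Fu; exists u.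
have mg i := continuous_measurable_borel (ohU i) (cg i).
have mh i (F : set (borelType Z)) : measurable F -> F `<=` U i ->
    measurable (h @` F : set (borelType Z)).
  by move=> mF FU; rewrite (img i)//; exact: mg.
(* The pushforward needs a map measurable on the whole space; the value chosen off the image of
   [U i] is cut away by the restriction to the image of [B i]. *)
pose G i z := if z \in h @` U i then g i z else point.
have GB i u : U i u -> G i (h u) = u.
  by move=> Uu; rewrite /G mem_set ?gh//; exists u.
have mG i : measurable_fun setT (G i : borelType Z -> borelType Z).
  move=> _ F mF; rewrite setTI.
  have -> : G i @^-1` F = (h @` U i `&` g i @^-1` F) `|`
      (~` (h @` U i) `&` (if point \in F then setT else set0)).
    apply/seteqP; split => z /=; rewrite /G.
      case: (boolP (z \in h @` U i)) => [/set_mem zU Fz|/negP nzU Fp].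
        by left.
      by right; split; [move=> zU; exact/nzU/mem_set|rewrite mem_set].
    case=> [[zU Fz]|[nzU]]; first by rewrite mem_set.
    have -> : (z \in h @` U i) = false by apply: memNset.
    by case: ifPn => [/set_mem//|_ []].
  apply: measurableU; first exact: mg.
  by apply: measurableI; [exact: measurableC|case: ifP].
have mhB i : measurable (h @` B i : set (borelType Z)) by exact: mh (BU i).
have pP i := restricted_pushforward nu (mG i) (mhB i).
have [p pE] := choice pP.
pose M := msum p k.
have ME F : M F = (\sum_(i < k) nu (G i @^-1` F `&` h @` B i))%E.
  by rewrite /M /msum; apply: eq_bigr => i _; have [-> _] := pE i.
have MT : (M setT < +oo)%E.
  rewrite ME; apply: lte_sum_pinfty => i _.
  by rewrite ltey_eq fin_num_measure// preimage_setT setTI.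
have [||mu muE] := @regular_measure_of R Z hZ cZ M.
- exact: MT.
- move=> E mE e e0.
  (* [M] is a sum of [k] terms and the neighbourhood of [E] a union of [k] pieces, so the total
     error is at most [k * k * d]. *)
  pose d := e / (k.+1%:R * k.+1%:R).
  have d0 : 0 < d by rewrite divr_gt0// mulr_gt0.
  have mE' i : measurable (h @` (E `&` U i) : set (borelType Z)).
    by apply: (mh i); [exact: measurableI|move=> x []].
  have [V VP] := choice (fun i => regular_outer_approximable
    (measure_of_regular nu) (mE' i) d0).
  (* An open set is chosen around the image of the part of [E] in [U i], then pulled back. As [h] is
     injective on [U i], points of [W i] outside [E] have images outside that image, so the excess
     is controlled by [nu]. *)
  pose W i := U i `&` h @^-1` V i.
  have oW i : open (W i).
    apply: openI => //; have [oV _ _] := VP i.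
    by move/continuousP : (local_homeo_continuous h_lh); apply.
  have mW i : measurable (W i : set (borelType Z)).
    exact: open_measurable_borel.
  have oWU : open (\big[setU/set0]_(i < k) W i).
    by rewrite -bigcup_mkord; apply: bigcup_open.
  exists (\big[setU/set0]_(i < k) W i); split => //.
    move=> w Ew; have [i ik Uw] := cov w; rewrite -bigcup_mkord.
    exists i => //; split => //; have [_ + _] := VP i; apply.
    by exists w.
  pose F i := W i `\` (E `&` U i).
  have mF i : measurable (F i : set (borelType Z)).
    by apply: measurableD => //; exact: measurableI.
  have MF i : (M (F i) <= (k%:R * d)%:E)%E.
    rewrite ME; apply: (@le_trans _ _ (\sum_(j < k) d%:E)%E).
      apply: lee_sum => j _; have [oV EV Vd] := VP i.
      apply: le_trans Vd; apply: le_measure.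
      - by rewrite inE; apply: measurableI => //; rewrite -[X in measurable X]setTI; exact: mG.
      - by rewrite inE; apply: measurableD => //; exact: open_measurable_borel.
      move=> _ [] /[swap] -[u Bu <-] /=; rewrite GB//; last exact: BU.
      move=> [[Uu Vu] nEu]; split => // -[x [Ex Ux] hx]; apply: nEu.
      by rewrite -(gh i u)// -hx gh.
    by rewrite sumEFin sumr_const card_ord mulr_natl.
  apply: (@le_trans _ _ (\sum_(i < k) M (F i))%E).
    apply: content_subadditive => //.
      by apply: measurableD => //; exact: open_measurable_borel.
    move=> w [+ nEw]; rewrite -!bigcup_mkord => -[i ik Ww].
    by exists i => //; split => // -[].
  apply: (@le_trans _ _ (\sum_(i < k) (k%:R * d)%:E)%E).
    by apply: lee_sum => i _; exact: MF.
  rewrite sumEFin lee_fin sumr_const card_ord -[leLHS]mulr_natl /d.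
  set K : R := k.+1%:R; have K0 : 0 < K by [].
  have kK : k%:R <= K by rewrite ler_nat.
  have -> : k%:R * (k%:R * (e / (K * K))) = e * (k%:R * k%:R / (K * K)) by ring.
  rewrite ler_piMr ?(ltW e0)// ler_pdivrMr ?mulr_gt0// mul1r.
  by rewrite ler_pM.
have mu_ge0 (a : Z -> R) : continuous a -> (forall z, 0 <= a z) ->
    integ mu a = integ nu (fiber_sum h a).
  move=> ca a0; apply: EFin_inj.
  have cfa := fiber_sum_continuous h_lh hZ cZ ca.
  have ma : measurable_fun setT (fun z : borelType Z => (a z)%:E).
    by apply/measurable_EFinP; exact: continuous_measurable_real.
  rewrite !integ_EFin// (@eq_measure_integral _ _ _ _ M); last first.
    by move=> A mA _; exact: muE.
  rewrite ge0_integral_measure_sum//; last by move=> z _; rewrite lee_fin.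
  transitivity (\sum_(i < k) \int[nu]_z ((\1_(h @` B i) z)%:E * (a (G i z))%:E))%E.
    by apply: eq_bigr => i _; have [_ ->] := pE i.
  rewrite -ge0_integral_sum//.
  - apply: eq_integral => z _; rewrite (@fiber_sum_pieces Z h R a k B G)//.
    + by rewrite -sumEFin.
    + by move=> i u /BU; exact: GB.
  - move=> i; apply: emeasurable_funM.
      exact/measurable_EFinP/measurable_indic.
    exact: (measurableT_comp ma (mG i)).
  - by move=> i z _; rewrite mule_ge0 ?lee_fin.
exists mu => a ca; have [K [b [K0 cb b0 ->]]] := continuous_nonneg_shift cZ ca.
have cK : continuous (fun _ : Z => K) by exact: cst_continuous.
have cfs (f : Z -> R) : continuous f -> continuous (fiber_sum h f).
  exact: fiber_sum_continuous.
rewrite fiber_sumB// integB// integB; [|exact: cZ|exact: cfs|exact: cfs].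
by rewrite !mu_ge0.
Qed.

(** Existence rules out the default branch of [xget]; [transfer] is not unfolded again. *)
Lemma integ_transfer nu (a : Z -> R) : continuous a ->
  integ (transfer h nu) a = integ nu (fiber_sum h a).
Proof.
rewrite /transfer; case: xgetP => [mu _ muP|noP]; first exact: muP.
by have [mu /noP] := transfer_exists nu.
Qed.

Lemma iter_fiber_sum_continuous (n : nat) (a : Z -> R) :
  continuous a -> continuous (iter n (fiber_sum h) a).
Proof.
by move=> ca; elim: n => [//|n IHn]; exact: fiber_sum_continuous.
Qed.

Lemma integ_iter_transfer nu (n : nat) (a : Z -> R) : continuous a ->
  integ (iter n (transfer h) nu) a = integ nu (iter n (fiber_sum h) a).
Proof.
elim: n a => [//|n IHn] a ca; rewrite iterS integ_transfer// IHn -?iterSr//.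
exact: fiber_sum_continuous.
Qed.

(** The counting function is the [n]-th iterate of the fiber sum on the constant 1. This links the
    masses in the series of measures to the terms of [f_beta]. *)
Lemma integ_iter_transfer1 nu (n : nat) :
  integ (iter n (transfer h) nu) (fun=> 1) =
  integ nu (fun z => (card_fiber h n z)%:R).
Proof.
rewrite integ_iter_transfer; last exact: cst_continuous.
congr (integ nu); elim: n => [|n IHn]; apply/funext => z.
  by rewrite card_fiber0.
by rewrite iterS IHn card_fiberS.
Qed.

Lemma integ_iter_transfer1_le nu (n : nat) :
  integ (iter n (transfer h) nu) (fun=> 1) <=
  (max_card_fiber h n)%:R * integ nu (fun=> 1).
Proof.
rewrite integ_iter_transfer1 -integ_cst//; apply: le_integ => //.
- exact: card_fiber_continuous.
- exact: cst_continuous.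
- by move=> z; rewrite ler_nat; exact: (card_fiber_max hZ cZ h_lh R).
Qed.

End Transfer.

(** * The function f_beta and convergence in the dual norm *)

(** Weierstrass test with an explicit remainder that depends on [v] alone, hence is the same at
    every point of the space. *)
Lemma series_tail_le (R : realType) (u v : nat -> R) :
  (forall n, 0 <= u n) -> (forall n, u n <= v n) -> cvgn (series v) ->
  cvgn (series u) /\
  forall N, `|series u N - limn (series u)| <= limn (series v) - series v N.
Proof.
move=> u0 uv cv; have v0 n : 0 <= v n by exact: le_trans (u0 n) (uv n).
have cu : cvgn (series u) by exact: (series_le_cvg u0 v0 uv cv).
split=> // N; have uN : series u N <= limn (series u).
  apply: nondecreasing_cvgn_le cu N; exact: nondecreasing_series.
rewrite ler0_norm ?subr_le0// opprB lerBlDr.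
have -> : limn (series v) - series v N + series u N =
    limn (fun n => series v n - series v N + series u N).
  apply/esym/cvg_lim => //; apply: cvgD; last exact: cvg_cst.
  by apply: cvgB => //; exact: cvg_cst.
apply: ler_lim => //.
  apply: is_cvgD; last exact: is_cvg_cst.
  by apply: is_cvgB => //; exact: is_cvg_cst.
near=> n; have Nn : (N <= n)%N by near: n; exists N.
rewrite -lerBlDr /series/= (big_cat_nat _ Nn)//= [leRHS](_ : _ = \sum_(N <= k < n) v k).
  by rewrite addrAC subrr add0r; apply: ler_sum.
by rewrite (big_cat_nat _ Nn)//= addrAC subrr add0r.
Unshelve. all: by end_near.
Qed.

Lemma uniform_cvg_dominated (T : choiceType) (R : realType)
    (f_ : nat -> T -> R) (f : T -> R) (t : nat -> R) :
  t @ \oo --> (0 : R) -> (forall n x, `|f_ n x - f x| <= t n) ->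
  {uniform, f_ @ \oo --> f}.
Proof.
move=> t0 ft P /uniform_nbhs[E [+ EP]].
rewrite -entourage_ballE => -[e /= e0 eE].
suff : \forall n \near \oo, P (f_ n) by [].
apply: filterS (cvgr_lt _ t0 _ e0) => n tn; apply: EP => x _.
by apply: eE; rewrite /= /ball/= distrC; apply: le_lt_trans tn.
Qed.

Section Proposition.
Context (R : realType) (Z : ptopologicalType) (h : Z -> Z).
Hypotheses (hZ : hausdorff_space Z) (cZ : compact [set: Z]).
Hypothesis h_lh : local_homeomorphism h.
Variable beta : R.
Hypothesis beta_gt : (beta_c R h < beta%:E)%E.
Implicit Types (mu nu eps : regular_measure R Z) (a b : Z -> R).

Let c (n : nat) : R := expR (- beta * n%:R) * (max_card_fiber h n)%:R.
Let cvg_c : cvgn (series c) := max_card_fiber_summable beta_gt.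
Let u (z : Z) (n : nat) : R := expR (- beta * n%:R) * (card_fiber h n z)%:R.

Let cst_cont (r : R) : continuous (fun _ : Z => r).
Proof. exact: cst_continuous. Qed.

Lemma expR_step (n : nat) :
  expR (- beta * n.+1%:R) = expR (- beta) * expR (- beta * n%:R) :> R.
Proof. by rewrite -natr1 mulrDr mulr1 expRD mulrC. Qed.

Lemma f_beta_partialE (N : nat) (z : Z) :
  f_beta_partial h beta N z = series (u z) N.
Proof. by rewrite /series/= big_mkord. Qed.

Lemma f_beta_cvg (z : Z) :
  f_beta_partial h beta N z @[N --> \oo] --> f_beta h beta z /\
  forall N, `|f_beta_partial h beta N z - f_beta h beta z| <=
    limn (series c) - series c N.
Proof.
have [||//|cu ule] := @series_tail_le R (u z) c.
- by move=> n; rewrite mulr_ge0 ?expR_ge0.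
- move=> n; rewrite ler_wpM2l ?expR_ge0// ler_nat.
  exact: (card_fiber_max hZ cZ h_lh R).
have E : (fun N => f_beta_partial h beta N z) = series (u z).
  by apply/funext => N; exact: f_beta_partialE.
split=> [|N]; first by rewrite /f_beta E.
by rewrite /f_beta E f_beta_partialE.
Qed.

Lemma tail_cvg0 : (limn (series c) - series c N) @[N --> \oo] --> (0 : R).
Proof.
rewrite -[X in _ --> X](subrr (limn (series c))).
by apply: cvgB => //; exact: cvg_cst.
Qed.

Lemma f_beta_uniform : {uniform, f_beta_partial h beta @ \oo --> f_beta h beta}.
Proof.
apply: uniform_cvg_dominated tail_cvg0 _ => N z.
by have [_] := f_beta_cvg z; apply.
Qed.

Lemma f_beta_partial_continuous (N : nat) :
  continuous (f_beta_partial h beta N).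
Proof.
move=> z; apply: cvg_sumr => n; apply: cvgM; first exact: cvg_cst.
exact: card_fiber_continuous.
Qed.

Lemma f_beta_continuous : continuous (f_beta h beta).
Proof.
apply: uniform_limit_continuous f_beta_uniform.
suff : \forall N \near \oo, continuous (f_beta_partial h beta N) by [].
by apply: nearW => N; exact: f_beta_partial_continuous.
Qed.

(** The term of index 0 is 1, and each later term is [expR (- beta)] times the fiber sum of its
    predecessor. The equation for [f_beta] is the limit of this recursion. *)
Lemma f_beta_partialS (N : nat) (z : Z) : f_beta_partial h beta N.+1 z =
  1 + fiber_sum h (fun w => expR (- beta) * f_beta_partial h beta N w) z.
Proof.
rewrite fiber_sumZ// /f_beta_partial big_ord_recl card_fiber0 mulr0 expR0 mulr1.
congr (1 + _); rewrite (fiber_sum_sum cZ h_lh N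
  (fun n w => expR (- beta * n%:R) * (card_fiber h n w)%:R)) mulr_sumr; apply: eq_bigr => n _.
by rewrite lift0 fiber_sumZ// -card_fiberS// expR_step mulrA.
Qed.

Lemma f_beta_eq (z : Z) : f_beta h beta z -
  \sum_(w \in h @^-1` [set z]) (expR (- beta) * f_beta h beta w) = 1.
Proof.
apply/eqP; rewrite subr_eq; apply/eqP.
have [cf _] := f_beta_cvg z.
have cf1 : f_beta_partial h beta N.+1 z @[N --> \oo] --> f_beta h beta z.
  by rewrite (cvg_shiftS (fun N => f_beta_partial h beta N z)).
have cf2 : f_beta_partial h beta N.+1 z @[N --> \oo] -->
    1 + fiber_sum h (fun w => expR (- beta) * f_beta h beta w) z.
  under eq_fun do rewrite f_beta_partialS.
  apply: cvgD; first exact: cvg_cst.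
  apply: fiber_sum_cvg => // w; apply: cvgM; first exact: cvg_cst.
  by have [] := f_beta_cvg w.
exact: (cvg_unique (@Rhausdorff R) cf1 cf2).
Qed.

Lemma integ_f_beta_cvg eps :
  integ eps (f_beta_partial h beta N) @[N --> \oo] -->
  integ eps (f_beta h beta).
Proof.
pose t N := (limn (series c) - series c N) * integ eps (fun=> 1).
have t0 : t @ \oo --> (0 : R).
  rewrite -[X in _ --> X](mul0r (integ eps (fun=> 1))).
  by apply: cvgM; [exact: tail_cvg0|exact: cvg_cst].
apply/cvgrPdist_le => e e0; near=> N.
apply: (@le_trans _ _ (t N)); last first.
  by apply: ltW; near: N; exact: (cvgr_lt _ t0 _ e0).
have cf : continuous (f_beta h beta) by exact: f_beta_continuous.
have cN : continuous (f_beta_partial h beta N).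
  exact: f_beta_partial_continuous.
rewrite -integB//; apply: integ_norm_le => // [z|z].
  by apply: cvgB; [exact: cf|exact: cN].
by rewrite distrC; have [_] := f_beta_cvg z; apply.
Unshelve. all: by end_near.
Qed.

Lemma dual_partial_sumE eps (a : Z -> R) (N : nat) :
  dual_partial_sum h beta eps N a =
  series (fun n => expR (- beta * n%:R) * integ (iter n (transfer h) eps) a) N.
Proof. by rewrite /series/= big_mkord. Qed.

Lemma dual_partial_sum1 eps (N : nat) :
  dual_partial_sum h beta eps N (fun=> 1) =
  integ eps (f_beta_partial h beta N).
Proof.
have fc n : continuous (fun z => expR (- beta * n%:R) * (card_fiber h n z)%:R).
  move=> z; apply: cvgM; first exact: cvg_cst.
  exact: card_fiber_continuous.
elim: N => [|N IHN].
  have -> : f_beta_partial h beta 0 = fun=> 0.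
    by apply/funext => z; rewrite /f_beta_partial big_ord0.
  by rewrite /dual_partial_sum big_ord0 integ_cst// mul0r.
have -> : f_beta_partial h beta N.+1 = fun z => f_beta_partial h beta N z +
    expR (- beta * N%:R) * (card_fiber h N z)%:R.
  by apply/funext => z; rewrite /f_beta_partial big_ord_recr.
have cN : continuous (f_beta_partial h beta N).
  exact: f_beta_partial_continuous.
rewrite integD//.
rewrite -IHN integZ//; last exact: card_fiber_continuous.
by rewrite /dual_partial_sum big_ord_recr/= integ_iter_transfer1.
Qed.

Lemma dual_partial_sumB eps (N : nat) a b : continuous a -> continuous b ->
  dual_partial_sum h beta eps N (fun z => a z - b z) =
  dual_partial_sum h beta eps N a - dual_partial_sum h beta eps N b.
Proof.
move=> ca cb; rewrite /dual_partial_sum -sumrB; apply: eq_bigr => n _.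
by rewrite integB// mulrBr.
Qed.

Lemma dual_partial_sumD eps (N : nat) a b : continuous a -> continuous b ->
  dual_partial_sum h beta eps N (fun z => a z + b z) =
  dual_partial_sum h beta eps N a + dual_partial_sum h beta eps N b.
Proof.
move=> ca cb; rewrite /dual_partial_sum -big_split; apply: eq_bigr => n _.
by rewrite integD// mulrDr.
Qed.

Lemma dual_partial_sumZ eps (N : nat) (r : R) a : continuous a ->
  dual_partial_sum h beta eps N (fun z => r * a z) =
  r * dual_partial_sum h beta eps N a.
Proof.
move=> ca; rewrite /dual_partial_sum mulr_sumr; apply: eq_bigr => n _.
by rewrite integZ// mulrCA.
Qed.

Lemma dual_partial_sum_le eps mu (N : nat) a : continuous a ->
  (forall z, 0 <= a z) ->
  dual_partial_sum h beta eps M a @[M --> \oo] --> integ mu a ->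
  dual_partial_sum h beta eps N a <= integ mu a.
Proof.
move=> ca a0 cva.
have E : dual_partial_sum h beta eps ^~ a = series (fun n =>
    expR (- beta * n%:R) * integ (iter n (transfer h) eps) a).
  by apply/funext => M; exact: dual_partial_sumE.
move: cva; rewrite dual_partial_sumE E => cva.
rewrite -(cvg_lim _ cva)//; apply: nondecreasing_cvgn_le; last first.
  by apply/cvg_ex; exists (integ mu a).
apply: nondecreasing_series => n _ _; rewrite mulr_ge0 ?expR_ge0//.
exact: integ_ge0.
Qed.

(* The remainder [mu - dual_partial_sum N] is a positive functional, so its
   norm is its value at the constant function 1. *)
Lemma is_norm_sumP eps mu : is_norm_sum h beta eps mu <->
  forall a, continuous a ->
    dual_partial_sum h beta eps N a @[N --> \oo] --> integ mu a.
Proof.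
pose D N a := dual_partial_sum h beta eps N a - integ mu a.
split=> [nmu a ca|cvmu].
  have [M M0 aM] := compact_continuous_bounded cZ ca.
  have cMa : continuous (fun z => M^-1 * a z).
    by move=> z; apply: cvgM; [exact: cvg_cst|exact: ca].
  apply/subr_cvg0/cvgrPdist_lt => e e0.
  have eM0 : (0 < (e / M)%:E)%E by rewrite lte_fin divr_gt0.
  have near_norm : \forall N \near \oo, (dual_norm (D N) < (e / M)%:E)%E.
    apply: (nmu [set x | (x < (e / M)%:E)%E]).
    by apply: open_nbhs_nbhs; split => //; exact: open_ereal_lt_ereal.
  suff : \forall N \near \oo, `|0 - D N a| < e by [].
  apply: filterS near_norm => N dN; rewrite sub0r normrN.
  have : (`|D N (fun z => M^-1 * a z)|%:E < (e / M)%:E)%E.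
    apply: le_lt_trans dN; apply: ereal_sup_ubound.
    exists (fun z => M^-1 * a z) => //; split => // z.
    by rewrite normrM gtr0_norm ?invr_gt0// mulrC ler_pdivrMr// mul1r.
  rewrite lte_fin /D dual_partial_sumZ// integZ// -mulrBr normrM.
  by rewrite gtr0_norm ?invr_gt0// mulrC ltr_pM2r ?invr_gt0.
have DN0 : (`|D N (fun=> 1)|%:E)%E @[N --> \oo] --> (0 : \bar R).
  apply: cvg_EFin; first exact: nearW.
  rewrite -[X in _ --> X](@normr0 R R); apply: cvg_norm.
  by apply/subr_cvg0; exact: cvmu.
apply: (@squeeze_cvge _ _ _ _ (fun=> 0%E) _ _ _ _ (cvg_cst _) DN0).
apply: nearW => N; apply/andP; split.
  apply: ereal_sup_ubound; exists (fun=> 0).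
    by split => // z; rewrite normr0.
  have I0 nu : integ nu (fun=> 0) = 0 by rewrite (integ_cst cZ nu 0) mul0r.
  rewrite I0 subr0 /dual_partial_sum big1 ?normr0// => n _.
  by rewrite I0 mulr0.
apply: ge_ereal_sup => _ [a [ca a1] <-]; rewrite lee_fin.
have D1 b : continuous b -> (forall z, 0 <= b z) -> D N b <= 0.
  by move=> cb b0; rewrite subr_le0; apply: dual_partial_sum_le => //; exact: cvmu.
(* [D N] is nonpositive on nonnegative functions; testing it on [1 - a] and [1 + a] bounds the
   absolute value of [D N a] by [- D N 1]. *)
have DB : D N (fun=> 1) - D N a <= 0.
  have -> : D N (fun=> 1) - D N a = D N (fun z => 1 - a z).
    by rewrite /D dual_partial_sumB// integB//; ring.
  apply: D1 => z.
    by apply: cvgB; [exact: cvg_cst|exact: ca].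
  by rewrite subr_ge0; have := a1 z; rewrite ler_norml => /andP[].
have DD : D N (fun=> 1) + D N a <= 0.
  have -> : D N (fun=> 1) + D N a = D N (fun z => 1 + a z).
    by rewrite /D dual_partial_sumD// integD//; ring.
  apply: D1 => z.
    by apply: cvgD; [exact: cvg_cst|exact: ca].
  by rewrite -lerBlDl sub0r; have := a1 z; rewrite ler_norml => /andP[].
rewrite -/(D N a) -/(D N (fun=> 1)).
rewrite (@ler0_norm _ (D N (fun=> 1))) ?D1//.
rewrite ler_norml opprK; lra.
Qed.
End Proposition.

(** * Subinvariant measures *)

Section NormSums.
Context (R : realType) (Z : ptopologicalType) (h : Z -> Z).
Hypotheses (hZ : hausdorff_space Z) (cZ : compact [set: Z]).
Hypothesis h_lh : local_homeomorphism h.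
Variable beta : R.
Hypothesis beta_gt : (beta_c R h < beta%:E)%E.
Implicit Types (mu nu eps : regular_measure R Z).

Let cS (a : Z -> R) (ca : continuous a) : continuous (fiber_sum h a) :=
  fiber_sum_continuous h_lh hZ cZ ca.

Let cst_cont (r : R) : continuous (fun _ : Z => r).
Proof. exact: cst_continuous. Qed.

Let expRNK : expR (- beta) * expR beta = 1.
Proof. by rewrite -expRD addNr expR0. Qed.

Lemma norm_sum_exists eps :
  exists mu : regular_measure R Z, is_norm_sum h beta eps mu.
Proof.
have [||mu mu_cvg] := @regular_measure_series R Z hZ cZ
  (fun n => iter n (transfer h) eps) (fun n => expR (- beta * n%:R)).
- by move=> n; exact: expR_ge0.
- pose K := integ eps (fun=> 1).
  pose v n := expR (- beta * n%:R) * (max_card_fiber h n)%:R * K.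
  apply: (@series_le_cvg _ _ v).
  + by move=> n; rewrite mulr_ge0 ?expR_ge0//; exact: integ_ge0.
  + by move=> n; rewrite !mulr_ge0 ?expR_ge0//; exact: integ_ge0.
  + move=> n; rewrite /v -mulrA ler_wpM2l ?expR_ge0//.
    exact: integ_iter_transfer1_le.
  have cv := max_card_fiber_summable beta_gt.
  have -> : series v = fun N => series (fun n =>
      expR (- beta * n%:R) * (max_card_fiber h n)%:R) N * K.
    by apply/funext => N; rewrite /series/= mulr_suml.
  by apply: is_cvgM => //; exact: is_cvg_cst.
exists mu; apply/(is_norm_sumP _ cZ) => a ca.
under eq_fun do rewrite dual_partial_sumE.
exact: mu_cvg.
Qed.

Lemma norm_sum_integ_transfer eps mu (a : Z -> R) : continuous a ->
  is_norm_sum h beta eps mu ->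
  integ (transfer h mu) a = expR beta * (integ mu a - integ eps a).
Proof.
move=> ca /(is_norm_sumP _ cZ) mu_cvg.
rewrite integ_transfer//.
have E N : dual_partial_sum h beta eps N (fiber_sum h a) =
    expR beta * (dual_partial_sum h beta eps N.+1 a - integ eps a).
  rewrite /dual_partial_sum big_ord_recl mulr0 expR0 mul1r addrAC subrr add0r.
  rewrite mulr_sumr; apply: eq_bigr => n _.
  rewrite lift0 expR_step -integ_transfer// !mulrA [expR beta * _]mulrC expRNK.
  by rewrite mul1r.
have S : dual_partial_sum h beta eps N.+1 a @[N --> \oo] --> integ mu a.
  by rewrite (cvg_shiftS (fun N => dual_partial_sum h beta eps N a)); exact: mu_cvg.
have L : dual_partial_sum h beta eps N (fiber_sum h a) @[N --> \oo] -->
    expR beta * (integ mu a - integ eps a).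
  under eq_fun do rewrite E.
  apply: cvgM; first exact: cvg_cst.
  by apply: cvgB; [exact: S|exact: cvg_cst].
exact: (cvg_unique (@Rhausdorff R) (mu_cvg _ (cS ca)) L).
Qed.

Lemma norm_sum_subinvariant eps mu :
  is_norm_sum h beta eps mu -> subinvariant h beta mu.
Proof.
move=> nmu a ca a0; rewrite (norm_sum_integ_transfer ca nmu).
by rewrite ler_wpM2l ?expR_ge0// gerBl; exact: integ_ge0.
Qed.

(** Subinvariance compares integrals; domination with constant [expR beta] turns it into an
    inequality on Borel sets, which makes the difference a positive measure. *)
Lemma subinvariant_defect mu : subinvariant h beta mu ->
  exists eps : regular_measure R Z, is_defect h beta mu eps /\
    forall a : Z -> R, continuous a ->
      integ eps a = integ mu a - expR (- beta) * integ (transfer h mu) a.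
Proof.
move=> sub_mu; apply: regular_measure_sub => // E mE.
have /(_ (expR_ge0 _)) := @integral_domination R Z hZ cZ (transfer h mu) mu
  (expR beta).
move=> /(_ sub_mu E mE) le_mu.
apply: (@le_trans _ _ ((expR (- beta))%:E * ((expR beta)%:E * mu E))%E).
  by apply: lee_wpmul2l => //; rewrite lee_fin expR_ge0.
by rewrite muleA -EFinM expRNK mul1e.
Qed.

(** The series determines only integrals. The defect of [mu] is therefore built as a separate
    regular measure and identified with [eps] because the integrals of continuous functions
    agree. *)
Lemma norm_sum_defect eps mu :
  is_norm_sum h beta eps mu -> is_defect h beta mu eps.
Proof.
move=> nmu; have [eps' [def_eps' integ_eps']] :=
  subinvariant_defect (norm_sum_subinvariant nmu).
have eq_integ (a : Z -> R) : continuous a -> integ eps a = integ eps' a.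
  move=> ca; rewrite integ_eps'// (norm_sum_integ_transfer ca nmu) mulrA expRNK.
  by rewrite mul1r opprB addrC subrK.
by move=> E mE; rewrite (regular_measure_integ_inj hZ cZ eq_integ mE) def_eps'.
Qed.

(** Testing the series on the constant 1 gives the integrals of the partial sums of [f_beta], and
    uniform convergence allows the limit under the integral. *)
Lemma norm_sum_total_mass eps mu : is_norm_sum h beta eps mu ->
  integ mu (fun=> 1) = integ eps (f_beta h beta).
Proof.
move=> /(is_norm_sumP _ cZ)/(_ _ (@cst_cont 1)) mu_cvg.
apply: (cvg_unique (@Rhausdorff R) mu_cvg).
suff -> : (fun N => dual_partial_sum h beta eps N (fun=> 1)) =
    (fun N => integ eps (f_beta_partial h beta N)).
  exact: integ_f_beta_cvg.
by apply/funext => N; exact: dual_partial_sum1.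
Qed.

Lemma is_probabilityP mu : is_probability mu <-> integ mu (fun=> 1) = 1.
Proof.
rewrite /is_probability -integ_cst1//.
by split=> [[]|->].
Qed.

Lemma defect_norm_sum eps mu :
  (forall a : Z -> R, continuous a ->
    integ eps a = integ mu a - expR (- beta) * integ (transfer h mu) a) ->
  is_norm_sum h beta eps mu.
Proof.
move=> integ_eps; apply/(is_norm_sumP _ cZ) => a ca.
pose rem N := expR (- beta * N%:R) * integ (iter N (transfer h) mu) a.
have telescope N : dual_partial_sum h beta eps N a = integ mu a - rem N.
  rewrite /dual_partial_sum; elim: N => [|N IHN].
    by rewrite big_ord0 /rem mulr0 expR0 mul1r subrr.
  (* The formula for [eps] is applied to the [N]-th iterated fiber sum of [a], so that the new term
     is [rem N - rem N.+1]. *)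
  rewrite big_ord_recr/= IHN /rem expR_step !integ_iter_transfer//.
  have cNa : continuous (iter N (fiber_sum h) a).
    exact: iter_fiber_sum_continuous.
  rewrite integ_eps// integ_transfer// -iterS.
  set x := integ mu a; set y := integ mu _; set w := integ mu _.
  set p := expR (- beta * _); set q := expR _.
  ring.
have [K K0 aK] := compact_continuous_bounded cZ ca.
pose t N := expR (- beta * N%:R) * (max_card_fiber h N)%:R *
  (K * integ mu (fun=> 1)).
have t0 : t @ \oo --> (0 : R).
  rewrite -[X in _ --> X](mul0r (K * integ mu (fun=> 1))).
  apply: cvgM; last exact: cvg_cst.
  exact: cvg_series_cvg_0 (max_card_fiber_summable beta_gt).
have rem_le N : `|rem N| <= t N.
  rewrite /rem normrM ger0_norm ?expR_ge0// /t -mulrA ler_wpM2l ?expR_ge0//.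
  apply: (@le_trans _ _ (K * integ (iter N (transfer h) mu) (fun=> 1))).
    exact: integ_norm_le.
  by rewrite mulrCA ler_wpM2l ?(ltW K0)//; exact: integ_iter_transfer1_le.
rewrite (funext telescope) -[X in _ --> X]subr0; apply: cvgB; first exact: cvg_cst.
apply/cvgr0Pnorm_le => e e0; near=> N.
apply: le_trans (rem_le N) _; apply: ltW.
by near: N; exact: (cvgr_lt _ t0 _ e0).
Unshelve. all: by end_near.
Qed.

End NormSums.

Theorem proposition4p2 (R : realType) (Z : ptopologicalType) (h : Z -> Z)
    (Z_hausdorff : hausdorff_space Z) (Z_compact : compact [set: Z])
    (h_local_homeo : local_homeomorphism h)
    (h_surj : set_surj [set: Z] [set: Z] h)
    (beta : R) (beta_gt : (beta_c R h < beta%:E)%E) :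
  [/\ (* (a) *)
      [/\ {uniform, f_beta_partial h beta @ \oo --> f_beta h beta},
          continuous (f_beta h beta) &
          forall z : Z,
            f_beta h beta z
            - \sum_(w \in h @^-1` [set z]) (expR (- beta) * f_beta h beta w)
            = 1],
      (* (b) *)
      (forall eps : regular_measure R Z,
         (exists mu : regular_measure R Z, is_norm_sum h beta eps mu) /\
         (forall mu : regular_measure R Z, is_norm_sum h beta eps mu ->
            [/\ subinvariant h beta mu,
                is_defect h beta mu eps &
                is_probability mu <-> integ eps (f_beta h beta) = 1])) &
      (* (c) *)
      (forall mu : regular_measure R Z,
         is_probability mu -> subinvariant h beta mu ->
         exists eps : regular_measure R Z,
           [/\ is_defect h beta mu eps,
               integ eps (f_beta h beta) = 1 &
               is_norm_sum h beta eps mu])].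
Proof.
split.
- split; first exact: f_beta_uniform.
    exact: f_beta_continuous.
  exact: f_beta_eq.
- move=> eps; split; first exact: norm_sum_exists.
  move=> mu nmu; split.
  + exact: norm_sum_subinvariant nmu.
  + exact: norm_sum_defect nmu.
  + rewrite -(norm_sum_total_mass _ _ _ _ nmu)//.
    exact: is_probabilityP.
- move=> mu pmu smu.
  have [eps [def_eps integ_eps]] :=
    subinvariant_defect Z_hausdorff Z_compact smu.
  have nmu : is_norm_sum h beta eps mu by exact: defect_norm_sum.
  exists eps; split=> //.
  rewrite -(norm_sum_total_mass _ _ _ _ nmu)//.
  exact/is_probabilityP.
Qed.
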